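(* Let $\mu$ be an infinite cardinal and $\lambda\geq\mu^{+3}$, and let $f\colon[\lambda]^4\to[\lambda]^{<\mu}$ be a set mapping such that for all $x_0<x_1<x_2<x_3$ in $\lambda$, $f\{x_0,x_1,x_2,x_3\}\cap(x_1,x_2)=\emptyset$, where $(x_1,x_2)=\{y\in\lambda: x_1<y<x_2\}$. Then for every natural number $m$, $f$ has a free set of size $m$.
   Context: For a set $S$, $[S]^k$ denotes the set of $k$-element subsets of $S$ and $[S]^{<\mu}$ the set of subsets of cardinality $<\mu$. A set mapping $f\colon[\lambda]^4\to[\lambda]^{<\mu}$ is a function with $f(\bar x)\cap\bar x=\emptyset$ for all $\bar x\in[\lambda]^4$; a set $H\subseteq\lambda$ is free for $f$ if $f(\bar x)\cap H=\emptyset$ for every $\bar x\in[H]^4$. *)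

(* Defs.v *)
From Stdlib Require Import List Relations Wellfounded.
Import ListNotations.

Definition card_le (A B : Type) : Prop :=
  exists f : A -> B, forall x y, f x = f y -> x = y.

Definition card_lt (A B : Type) : Prop := card_le A B /\ ~ card_le B A.

Definition sub {T : Type} (P : T -> Prop) : Type := {x : T | P x}.

Definition infinite_type (M : Type) : Prop := card_le nat M.

(* (T, lt) is a cardinal lambda viewed as a von Neumann ordinal: a strict
   well-order, every proper initial segment of which has smaller cardinality
   (i.e. lambda is an initial ordinal). *)
Definition is_initial_ordinal (T : Type) (lt : T -> T -> Prop) : Prop :=
  (forall x, ~ lt x x) /\
  (forall x y z, lt x y -> lt y z -> lt x z) /\
  (forall x y, lt x y \/ x = y \/ lt y x) /\
  well_founded lt /\
  (forall x, card_lt (sub (fun y => lt y x)) T).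

(* |T| >= |M|^{+3}: there are cardinals kappa1 < kappa2 < kappa3 <= |T|
   with |M| < kappa1 (cardinals are well-ordered, classically). *)
Definition card_ge_succ3 (M T : Type) : Prop :=
  exists A1 A2 A3 : T -> Prop,
    card_lt M (sub A1) /\ card_lt (sub A1) (sub A2) /\ card_lt (sub A2) (sub A3).

(* A set mapping on [T]^4, given on increasing 4-tuples x0<x1<x2<x3
   (which correspond bijectively to 4-element subsets), with values
   of cardinality < |M| disjoint from the argument. *)
Definition set_mapping4 (T M : Type) (lt : T -> T -> Prop)
    (f : T -> T -> T -> T -> T -> Prop) : Prop :=
  forall x0 x1 x2 x3, lt x0 x1 -> lt x1 x2 -> lt x2 x3 ->
    card_lt (sub (f x0 x1 x2 x3)) M /\
    ~ f x0 x1 x2 x3 x0 /\ ~ f x0 x1 x2 x3 x1 /\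
    ~ f x0 x1 x2 x3 x2 /\ ~ f x0 x1 x2 x3 x3.

Definition free_set {T : Type} (lt : T -> T -> Prop)
    (f : T -> T -> T -> T -> T -> Prop) (H : list T) : Prop :=
  forall x0 x1 x2 x3, In x0 H -> In x1 H -> In x2 H -> In x3 H ->
    lt x0 x1 -> lt x1 x2 -> lt x2 x3 ->
    forall y, In y H -> ~ f x0 x1 x2 x3 y.

(* Main.v *)
(* For a fixed top element a, "y between x2 and a" and "y above x3" are avoided
   by closure, "y below x1" by a free-set argument; the two are combined as follows.
   Write K > |M| and let p_0 < p_1 < ... be ordinals of cardinality at most |K|^+
   such that whatever p_(n+1) satisfies with respect to finitely many members of
   a fixed filtration of p_n into |K|^+ many sets of size |K| is satisfied by more
   than |K| many a in (p_n, p_(n+1)).  Choose sets X_0, X_1, ... of size |K|, all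
   containing every p_i, increasing, closed under f and with traces X_n cap p_i in
   the filtration of p_i.  By reflection there are blocks A_n, contained in
   (p_n, p_(n+1)) and in X_n, disjoint from X_i for i < n, of size > |M|, such that
   X_i cap p_n is closed under f(., ., ., a) below p_n for all a in A_n, i < n.
   Then every transversal H of the blocks is free for y in (x2, x3) and y > x3:
   if y is in A_(i+1), then f(x0, x1, x2, x3) meets the relevant part of T inside
   X_i only.  The transversal is chosen from the top block down: once x1, x2, x3
   are chosen, the lower blocks are shrunk to subsets of size > |M| such that no
   f(x, x1, x2, x3) with x in one of them meets another one, which handles y < x1. *)
Require Import Defs.
From Stdlib Require Import List Arith Lia Classical ClassicalEpsilon Cantor.
From Stdlib Require Import FunctionalExtensionality PropExtensionality.
From mathcomp Require classical_sets.
Import ListNotations.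
Set Bullet Behavior "Strict Subproofs".

(** * Choice, Zorn's lemma and comparability of cardinals *)

(** Encodes |P| <= |K| by a map on all of [T] that is injective on [P] only, which avoids subset
    types; for inhabited [K] it agrees with [card_le (sub P) K]. *)
Definition small (K : Type) {T : Type} (P : T -> Prop) : Prop :=
  exists g : T -> K, forall x y, P x -> P y -> g x = g y -> x = y.

Lemma choice_on {A B : Type} (R : A -> B -> Prop) :
  (forall x, exists y, R x y) -> exists g : A -> B, forall x, R x (g x).
Proof.
  intros H. exists (fun x => proj1_sig (constructive_indefinite_description _ (H x))).
  intros x. exact (proj2_sig (constructive_indefinite_description _ (H x))).
Qed.

Lemma choice_on_pred {A B : Type} (b : B) (P : A -> Prop) (R : A -> B -> Prop) :
  (forall x, P x -> exists y, R x y) ->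
  exists g : A -> B, forall x, P x -> R x (g x).
Proof.
  intros H. apply (choice_on (fun x y => P x -> R x y)). intros x.
  destruct (classic (P x)) as [h | h].
  - destruct (H x h) as [y hy]. exists y. auto.
  - exists b. tauto.
Qed.

(** The empty chain is among the families [F], so the hypothesis also makes the empty set satisfy
    [P]. *)
Lemma zorn_union {X : Type} (P : (X -> Prop) -> Prop) :
  (forall F : (X -> Prop) -> Prop,
     (forall A, F A -> P A) ->
     (forall A B, F A -> F B ->
        (forall x, A x -> B x) \/ (forall x, B x -> A x)) ->
     P (fun x => exists A, F A /\ A x)) ->
  exists A, P A /\
    forall B, P B -> (forall x, A x -> B x) -> forall x, B x -> A x.
Proof.
  intros H.
  destruct (@classical_sets.Zorn_bigcup X P) as [A [PA maxA]].
  - intros F FP totF.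
    assert (E : classical_sets.bigcup F (fun A => A) = (fun x => exists A, F A /\ A x)).
    { apply functional_extensionality. intros x. apply propositional_extensionality.
      split.
      - intros [A FA Ax]. exists A. auto.
      - intros [A [FA Ax]]. exists A; auto. }
    rewrite E. apply H; [exact FP | exact totF].
  - exists A. split; [exact PA |]. intros B PB AB.
    apply NNPP. intros h. apply (maxA B); [split; assumption | exact PB].
Qed.

Lemma card_le_refl (A : Type) : card_le A A.
Proof. exists (fun x => x). auto. Qed.

Lemma card_le_trans (A B C : Type) : card_le A B -> card_le B C -> card_le A C.
Proof. intros [f hf] [g hg]. exists (fun x => g (f x)). auto. Qed.

(** A maximal partial injection is total or onto, since otherwise a pair of unmatched elements
    extends it. *)
Lemma card_le_total (A B : Type) : card_le A B \/ card_le B A.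
Proof.
  destruct (@zorn_union (A * B) (fun R =>
      (forall a b b', R (a, b) -> R (a, b') -> b = b') /\
      (forall a a' b, R (a, b) -> R (a', b) -> a = a'))) as [R [[fR iR] maxR]].
  - intros F FP Fchain. split.
    + intros a b b' [S [FS h]] [S' [FS' h']].
      destruct (Fchain S S' FS FS') as [i | i].
      * apply (proj1 (FP S' FS') a); auto.
      * apply (proj1 (FP S FS) a); auto.
    + intros a a' b [S [FS h]] [S' [FS' h']].
      destruct (Fchain S S' FS FS') as [i | i].
      * apply (proj2 (FP S' FS') a a' b); auto.
      * apply (proj2 (FP S FS) a a' b); auto.
  - destruct (classic (forall a, exists b, R (a, b))) as [tA | nA].
    + left. destruct (choice_on _ tA) as [g hg]. exists g. intros x y e.
      apply (iR x y (g x)); [apply hg | rewrite e; apply hg].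
    + destruct (classic (forall b, exists a, R (a, b))) as [tB | nB].
      * right. destruct (choice_on _ tB) as [g hg]. exists g. intros x y e.
        apply (fR (g x) x y); [apply hg | rewrite e; apply hg].
      * exfalso. apply not_all_ex_not in nA. destruct nA as [a na].
        apply not_all_ex_not in nB. destruct nB as [b nb].
        apply na. exists b.
        apply (maxR (fun p => R p \/ p = (a, b))); [split | auto | auto].
        -- intros x y y' [h | h] [h' | h'].
           ++ eauto.
           ++ injection h' as -> ->. exfalso. eauto.
           ++ injection h as -> ->. exfalso. eauto.
           ++ congruence.
        -- intros x x' y [h | h] [h' | h'].
           ++ eauto.
           ++ injection h' as -> ->. exfalso. eauto.
           ++ injection h as -> ->. exfalso. eauto.
           ++ congruence.
Qed.

(** * Small sets and infinite cardinal arithmetic *)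

Lemma small_card_le (K T : Type) (P : T -> Prop) :
  small K P -> card_le (sub P) K.
Proof.
  intros [g hg]. exists (fun x => g (proj1_sig x)).
  intros [x hx] [y hy] e. simpl in e.
  assert (x = y) by auto. subst y. f_equal. apply proof_irrelevance.
Qed.

Lemma card_le_small (K T : Type) (P : T -> Prop) (k : K) :
  card_le (sub P) K -> small K P.
Proof.
  intros [g hg].
  exists (fun x => match excluded_middle_informative (P x) with
                   | left h => g (exist P x h) | right _ => k end).
  intros x y hx hy.
  destruct (excluded_middle_informative (P x)) as [px |]; [| tauto].
  destruct (excluded_middle_informative (P y)) as [py |]; [| tauto].
  intros e. apply hg in e. congruence.
Qed.

Lemma small_sub (K T : Type) (P Q : T -> Prop) :
  (forall x, P x -> Q x) -> small K Q -> small K P.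
Proof. intros h [g hg]. exists g. auto. Qed.

Lemma small_le (K L T : Type) (P : T -> Prop) :
  card_le K L -> small K P -> small L P.
Proof. intros [j hj] [g hg]. exists (fun x => j (g x)). auto. Qed.

Lemma small_full (K T : Type) : card_le T K -> small K (fun _ : T => True).
Proof. intros [g hg]. exists g. auto. Qed.

(* Hessenberg's theorem, by Zorn's lemma on the pairs (D, injection of D * D
   into D): a maximal D has the cardinality of A, as otherwise the complement
   contains a copy j(D) of D and the injection extends to D and j(D). *)
Lemma card_le_square (A : Type) : infinite_type A -> card_le (A * A) A.
Proof.
  intros [e he].
  (* A pair (D, injection) is coded as one subset of a sum: [inr] holds D and [inl] the graph. The
     last clause puts the range of [e] into every nonempty D, yet admits the empty set, as the empty
     chain demands. *)
  set (isP := fun S : (A * A) * A + A -> Prop =>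
    (forall x y z z', S (inl (x, y, z)) -> S (inl (x, y, z')) -> z = z') /\
    (forall x y x' y' z, S (inl (x, y, z)) -> S (inl (x', y', z)) -> x = x' /\ y = y') /\
    (forall x y z, S (inl (x, y, z)) -> S (inr x) /\ S (inr y) /\ S (inr z)) /\
    (forall x y, S (inr x) -> S (inr y) -> exists z, S (inl (x, y, z))) /\
    (forall x n, S (inr x) -> S (inr (e n)))).
  destruct (@zorn_union _ isP) as [S [(fS & iS & dS & tS & eS) maxS]].
  { intros F FP Fchain.
    assert (up : forall u v, (exists S, F S /\ S u) -> (exists S, F S /\ S v) ->
              exists S, F S /\ S u /\ S v).
    { intros u v [S [FS h]] [S' [FS' h']].
      destruct (Fchain S S' FS FS') as [i | i]; eauto 6. }
    split; [| split; [| split; [| split]]].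
    - intros x y z z' h h'. destruct (up _ _ h h') as (S & FS & s & s').
      destruct (FP S FS) as (p & _). eauto.
    - intros x y x' y' z h h'. destruct (up _ _ h h') as (S & FS & s & s').
      destruct (FP S FS) as (_ & p & _). eauto.
    - intros x y z (S & FS & s). destruct (FP S FS) as (_ & _ & p & _).
      destruct (p x y z s) as (? & ? & ?). split; [| split]; exists S; auto.
    - intros x y h h'. destruct (up _ _ h h') as (S & FS & s & s').
      destruct (FP S FS) as (_ & _ & _ & p & _).
      destruct (p x y s s') as [z hz]. eauto.
    - intros x n (S & FS & s). exists S. split; [auto |].
      destruct (FP S FS) as (_ & _ & _ & _ & p). eauto. }
  assert (ne : exists x, S (inr x)).
  { apply NNPP. intros no. apply no. exists (e 0).
    apply (maxS (fun u => match u with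
       | inl (x, y, z) => exists m n, x = e m /\ y = e n /\ z = e (Cantor.to_nat (m, n))
       | inr x => exists n, x = e n end)).
    - split; [| split; [| split; [| split]]].
      + intros x y z z' (m & n & -> & -> & ->) (m' & n' & E1 & E2 & ->).
        apply he in E1. apply he in E2. congruence.
      + intros x y x' y' z (m & n & -> & -> & ->) (m' & n' & -> & -> & E).
        apply he in E. apply Cantor.to_nat_inj in E. split; congruence.
      + intros x y z (m & n & -> & -> & ->). split; [| split]; eauto.
      + intros x y [m ->] [n ->]. exists (e (Cantor.to_nat (m, n))), m, n. auto.
      + eauto.
    - intros [[[x y] z] | x] h.
      + exfalso. apply no. exists x. apply (dS _ _ _ h).
      + exfalso. eauto.
    - eauto. }
  destruct ne as [x0 hx0].
  set (D := fun x => S (inr x)) in *.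
  assert (De : forall n, D (e n)) by (intros n; apply (eS x0 n hx0)).
  assert (hp : exists p : A * A -> A, forall u, D (fst u) /\ D (snd u) -> S (inl (u, p u))).
  { apply (choice_on_pred x0 (fun u => D (fst u) /\ D (snd u)) (fun u z => S (inl (u, z)))).
    intros [x y] [dx dy]. apply (tS x y dx dy). }
  destruct hp as [p hp].
  assert (Dp : forall x y, D x -> D y -> D (p (x, y))).
  { intros x y dx dy. apply (dS x y (p (x, y))). apply hp; auto. }
  assert (ip : forall x y x' y', D x -> D y -> D x' -> D y' ->
            p (x, y) = p (x', y') -> x = x' /\ y = y').
  { intros x y x' y' dx dy dx' dy' E. apply (iS x y x' y' (p (x, y))).
    - apply hp; auto.
    - rewrite E. apply hp; auto. }
  destruct (card_le_total (sub (fun x => ~ D x)) (sub D)) as [ED | DE].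
  - destruct ED as [c hc].
    (* The tags [e 0] and [e 1] embed D and its complement side by side into D. *)
    set (d := fun x => match excluded_middle_informative (D x) with
                | left h => p (e 0, x)
                | right h => p (e 1, proj1_sig (c (exist (fun x => ~ D x) x h))) end).
    assert (Dd : forall x, D (d x)).
    { intros x. unfold d. destruct (excluded_middle_informative (D x)); apply Dp; auto.
      apply proj2_sig. }
    assert (id : forall x y, d x = d y -> x = y).
    { intros x y. unfold d.
      destruct (excluded_middle_informative (D x)) as [dx | dx],
        (excluded_middle_informative (D y)) as [dy | dy]; intros E;
        apply ip in E; auto; try apply proj2_sig; destruct E as [E1 E2].
      - auto.
      - apply he in E1. discriminate.
      - apply he in E1. discriminate.
      - assert (E3 : c (exist (fun x => ~ D x) x dx) = c (exist (fun x => ~ D x) y dy)).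
        { destruct (c (exist (fun x => ~ D x) x dx)), (c (exist (fun x => ~ D x) y dy)).
          simpl in E2. subst. f_equal. apply proof_irrelevance. }
        apply hc in E3. congruence. }
    exists (fun u => p (d (fst u), d (snd u))).
    intros [x y] [x' y'] E. simpl in E. apply ip in E; auto.
    destruct E as [E1 E2]. apply id in E1. apply id in E2. congruence.
  - exfalso. destruct DE as [c hc].
    assert (hj : exists j : A -> A, forall x, D x -> exists h : D x,
                j x = proj1_sig (c (exist D x h))).
    { apply (choice_on_pred x0 D (fun x y => exists h : D x, y = proj1_sig (c (exist D x h)))).
      intros x h. exists (proj1_sig (c (exist D x h))), h. reflexivity. }
    destruct hj as [j hj].
    assert (nj : forall x, D x -> ~ D (j x)).
    { intros x dx. destruct (hj x dx) as [h ->]. apply proj2_sig. }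
    assert (ij : forall x y, D x -> D y -> j x = j y -> x = y).
    { intros x y dx dy. destruct (hj x dx) as [h ->], (hj y dy) as [h' ->]. intros E.
      assert (E3 : c (exist D x h) = c (exist D y h')).
      { destruct (c (exist D x h)), (c (exist D y h')).
        simpl in E. subst. f_equal. apply proof_irrelevance. }
      apply hc in E3. congruence. }
    set (emb := fun (b : bool) x => if b then j x else x).
    assert (iemb : forall b b' x y, D x -> D y -> emb b x = emb b' y -> b = b' /\ x = y).
    { intros [] [] x y dx dy E; simpl in E; auto.
      - subst y. destruct (nj x dx dy).
      - subst x. destruct (nj y dy dx). }
    set (code := fun b b' : bool => e ((if b then 1 else 0) + (if b' then 2 else 0))).
    assert (icode : forall a b a' b', code a b = code a' b' -> a = a' /\ b = b').
    { intros [] [] [] [] E; apply he in E; simpl in E; try discriminate; auto. }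
    assert (Dcode : forall a b, D (code a b)) by (intros; apply De).
    (* Pairs with at least one coordinate in j(D) get values in j(D), hence no old value is hit;
       [code] records which coordinates lie there. *)
    set (N := fun x y z => exists a b x' y', D x' /\ D y' /\ x = emb a x' /\ y = emb b y' /\
                (a || b)%bool = true /\ z = j (p (code a b, p (x', y')))).
    assert (nN : forall x y z, N x y z -> ~ (D x /\ D y) /\ ~ D z).
    { intros x y z (a & b & x' & y' & dx & dy & -> & -> & ab & ->). split.
      - intros [h h']. destruct a; [exact (nj x' dx h) |].
        destruct b; [exact (nj y' dy h') | discriminate].
      - apply nj. auto. }
    assert (contra : D (j x0)); [| exact (nj x0 hx0 contra)].
    apply (maxS (fun u => match u with
       | inl (x, y, z) => S (inl (x, y, z)) \/ N x y z
       | inr x => exists a x', D x' /\ x = emb a x' end)).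
    + split; [| split; [| split; [| split]]].
      * intros x y z z' [h | h] [h' | h'].
        -- eauto.
        -- destruct (nN _ _ _ h') as [q _]. destruct (dS _ _ _ h) as (? & ? & ?). tauto.
        -- destruct (nN _ _ _ h) as [q _]. destruct (dS _ _ _ h') as (? & ? & ?). tauto.
        -- destruct h as (a & b & x1 & y1 & dx & dy & -> & -> & ab & ->),
             h' as (a' & b' & x2 & y2 & dx' & dy' & E1 & E2 & ab' & ->).
           apply iemb in E1; auto. apply iemb in E2; auto.
           destruct E1, E2. congruence.
      * intros x y x' y' z [h | h] [h' | h'].
        -- apply (iS _ _ _ _ _ h h').
        -- destruct (nN _ _ _ h') as [_ q]. destruct (dS _ _ _ h) as (? & ? & ?). tauto.
        -- destruct (nN _ _ _ h) as [_ q]. destruct (dS _ _ _ h') as (? & ? & ?). tauto.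
        -- destruct h as (a & b & x1 & y1 & dx & dy & -> & -> & ab & ->),
             h' as (a' & b' & x2 & y2 & dx' & dy' & -> & -> & ab' & E).
           apply ij in E; auto. apply ip in E; auto. destruct E as [E1 E2].
           apply icode in E1. apply ip in E2; auto. destruct E1, E2. split; congruence.
      * intros x y z [h | h].
        -- destruct (dS _ _ _ h) as (? & ? & ?).
           split; [| split]; [exists false, x | exists false, y | exists false, z]; auto.
        -- destruct h as (a & b & x1 & y1 & dx & dy & -> & -> & ab & ->).
           split; [| split]; [exists a, x1 | exists b, y1 | exists true]; eauto.
      * intros x y (a & x1 & dx & ->) (b & y1 & dy & ->).
        destruct ((a || b)%bool) eqn:ab.
        -- eexists. right. exists a, b, x1, y1. repeat split; auto.
        -- destruct a, b; try discriminate. simpl.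
           destruct (tS x1 y1 dx dy) as [z hz]. eauto.
      * intros x n _. exists false, (e n). auto.
    + intros [[[x y] z] | x] h; [auto |]. exists false, x. auto.
    + exists true, x0. auto.
Qed.

Lemma card_le_prod (A B C D : Type) :
  card_le A C -> card_le B D -> card_le (A * B) (C * D).
Proof.
  intros [f hf] [g hg]. exists (fun u => (f (fst u), g (snd u))).
  intros [a b] [a' b'] E. injection E as E1 E2. apply hf in E1. apply hg in E2.
  congruence.
Qed.

Lemma infinite_le (A B : Type) : infinite_type A -> card_le A B -> infinite_type B.
Proof. apply card_le_trans. Qed.

Lemma card_le_list (A : Type) : infinite_type A -> card_le (list A) A.
Proof.
  intros iA. assert (sq := card_le_square A iA). destruct iA as [e he], sq as [p hp].
  set (code := fix code l := match l with
    | nil => p (e 0, e 0)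
    | x :: l => p (e 1, p (x, code l)) end).
  exists code. intros l. induction l as [| x l IH]; intros [| x' l'] E; simpl in E.
  - reflexivity.
  - apply hp in E. injection E as E _. apply he in E. discriminate.
  - apply hp in E. injection E as E _. apply he in E. discriminate.
  - apply hp in E. injection E as E. apply hp in E. injection E as -> E.
    apply IH in E. congruence.
Qed.

Lemma small_Union (K I T : Type) (J : I -> Prop) (F : I -> T -> Prop) :
  infinite_type K -> small K J -> (forall i, J i -> small K (F i)) ->
  small K (fun x => exists i, J i /\ F i x).
Proof.
  intros iK [gJ hJ] hF.
  destruct (card_le_square K iK) as [p hp]. destruct iK as [e _].
  destruct (choice_on_pred (fun _ : T => e 0) J
    (fun i g => forall x y, F i x -> F i y -> g x = g y -> x = y) hF) as [g hg].
  destruct (classic (exists i, J i)) as [[i0 _] | no].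
  - destruct (choice_on_pred i0 (fun x => exists i, J i /\ F i x)
      (fun x i => J i /\ F i x) (fun x h => h)) as [idx hidx].
    exists (fun x => p (gJ (idx x), g (idx x) x)). intros x y hx hy E.
    apply hp in E. injection E as E1 E2.
    destruct (hidx x hx) as [Jx Fx], (hidx y hy) as [Jy Fy].
    apply hJ in E1; auto. rewrite E1 in *. eapply hg; eauto.
  - exists (fun _ => e 0). intros x y [i [h _]]. exfalso. eauto.
Qed.

Lemma infinite_bool (K : Type) : infinite_type K -> card_le bool K.
Proof.
  intros [e he]. exists (fun b : bool => e (if b then 1 else 0)).
  intros [] [] E; apply he in E; congruence.
Qed.

Lemma small_or (K T : Type) (P Q : T -> Prop) :
  infinite_type K -> small K P -> small K Q -> small K (fun x => P x \/ Q x).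
Proof.
  intros iK hP hQ.
  apply (small_sub K T _ (fun x => exists b : bool, True /\ (if b then P x else Q x))).
  - intros x [h | h]; [exists true | exists false]; auto.
  - apply small_Union; [exact iK | |].
    + apply small_full, infinite_bool, iK.
    + intros [] _; assumption.
Qed.

Lemma small_singleton (K T : Type) (a : T) : infinite_type K -> small K (fun x => x = a).
Proof. intros [e _]. exists (fun _ => e 0). congruence. Qed.

Lemma small_image (K S T : Type) (P : S -> Prop) (f : S -> T) :
  infinite_type K -> small K P -> small K (fun y => exists x, P x /\ y = f x).
Proof.
  intros iK hP. apply small_Union; auto. intros x _. apply small_singleton, iK.
Qed.

Lemma small_pair (K S T : Type) (P : S -> Prop) (Q : T -> Prop) :
  infinite_type K -> small K P -> small K Q -> small K (fun u => P (fst u) /\ Q (snd u)).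
Proof.
  intros iK [f hf] [g hg]. destruct (card_le_square K iK) as [p hp].
  exists (fun u => p (f (fst u), g (snd u))). intros [x y] [x' y'] [h1 h2] [h3 h4] E.
  apply hp in E. injection E as E1 E2. apply hf in E1; auto. apply hg in E2; auto.
  simpl in *. congruence.
Qed.

Lemma not_small_inhabited (K T : Type) (P : T -> Prop) :
  infinite_type K -> ~ small K P -> exists x, P x.
Proof.
  intros [e _] h. apply NNPP. intros no. apply h. exists (fun _ => e 0).
  intros x y hx. exfalso. eauto.
Qed.

Lemma not_small_infinite (K T : Type) (P : T -> Prop) :
  infinite_type K -> ~ small K P -> card_le K (sub P).
Proof.
  intros iK h. destruct (card_le_total K (sub P)) as [l | l]; [exact l |].
  exfalso. apply h. destruct iK as [e _]. apply (card_le_small _ _ _ (e 0) l).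
Qed.

Lemma small_diff (K T : Type) (P Q : T -> Prop) :
  infinite_type K -> ~ small K P -> small K Q -> ~ small K (fun x => P x /\ ~ Q x).
Proof.
  intros iK hP hQ h. apply hP.
  apply (small_sub _ _ _ (fun x => (P x /\ ~ Q x) \/ Q x)).
  - intros x px. destruct (classic (Q x)); auto.
  - apply small_or; assumption.
Qed.

(** The image of an embedding of [K] works. It cuts a block down to size |K|, so that a closed set
    of size |K| can contain it, while keeping it larger than |M|. *)
Lemma not_small_subset (M K T : Type) (P : T -> Prop) :
  infinite_type K -> ~ card_le K M -> ~ small K P ->
  exists Q : T -> Prop, (forall x, Q x -> P x) /\ small K Q /\ ~ small M Q.
Proof.
  intros iK KM hP. destruct (not_small_infinite K T P iK hP) as [j hj].
  exists (fun x => exists k, True /\ x = proj1_sig (j k)). split; [| split].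
  - intros x [k [_ ->]]. apply proj2_sig.
  - apply small_image; [exact iK | apply small_full, card_le_refl].
  - intros [g hg]. apply KM. exists (fun k => g (proj1_sig (j k))). intros x y E.
    apply hj. apply hg in E; eauto.
    destruct (j x), (j y). simpl in E. subst. f_equal. apply proof_irrelevance.
Qed.

(** * Free subsets of large sets *)

(* Cut B into M many large pieces: a set of size < |M| misses one of them, and
   the same piece is missed by F x for a large set of x. *)
Lemma large_free_pair (M T : Type) (F : T -> T -> Prop) (A B : T -> Prop) :
  infinite_type M -> (forall x, A x -> ~ card_le M (sub (F x))) ->
  ~ small M A -> ~ small M B ->
  exists A' B' : T -> Prop,
    (forall x, A' x -> A x) /\ (forall x, B' x -> B x) /\
    ~ small M A' /\ ~ small M B' /\ (forall x y, A' x -> B' y -> ~ F x y).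
Proof.
  intros iM hF hA hB.
  assert (MB := not_small_infinite M T B iM hB).
  destruct (card_le_trans (sub B * M) (sub B * sub B) (sub B)) as [j hj].
  { apply card_le_prod; [apply card_le_refl | exact MB]. }
  { apply card_le_square. exact (infinite_le _ _ iM MB). }
  (* The images of the slices B x {m} under an injection of B x M into B are pairwise disjoint
     copies of B. *)
  set (piece := fun m y => exists b, y = proj1_sig (j (b, m))).
  assert (pj : forall u v, proj1_sig (j u) = proj1_sig (j v) -> u = v).
  { intros u v E. apply hj. destruct (j u), (j v). simpl in E. subst. f_equal.
    apply proof_irrelevance. }
  (* Choosing a point of [F x] in every piece would inject [M] into [F x]. *)
  assert (miss : forall x, A x -> exists m, forall y, piece m y -> ~ F x y).
  { intros x ax. apply NNPP. intros no. apply (hF x ax).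
    destruct (choice_on (fun m (y : sub (F x)) => piece m (proj1_sig y))) as [c hc].
    { intros m. apply NNPP. intros no'. apply no. exists m. intros y py fy. apply no'.
      exists (exist _ y fy). exact py. }
    exists c. intros m m' E. destruct (hc m) as [b hb], (hc m') as [b' hb'].
    rewrite E, hb' in hb. apply pj in hb. congruence. }
  assert (big : exists m, ~ small M (fun x => A x /\ forall y, piece m y -> ~ F x y)).
  { apply NNPP. intros no. apply hA.
    apply (small_sub _ _ _ (fun x => exists m, True /\
             (A x /\ forall y, piece m y -> ~ F x y))).
    - intros x ax. destruct (miss x ax) as [m hm]. eauto.
    - apply small_Union; [exact iM | apply small_full, card_le_refl |].
      intros m _. apply NNPP. intros h. eauto. }
  destruct big as [m hm].
  exists (fun x => A x /\ forall y, piece m y -> ~ F x y), (piece m).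
  split; [tauto |]. split; [| split; [exact hm |]; split].
  - intros y [b ->]. apply proj2_sig.
  - intros [g hg]. apply hB. destruct iM as [e _].
    apply (card_le_small _ _ _ (e 0)).
    exists (fun b => g (proj1_sig (j (b, m)))). intros b b' E.
    apply hg in E; try (eexists; reflexivity). apply pj in E. congruence.
  - intros x y [_ h]. auto.
Qed.

(** The tasks are met one after the other, as freeness survives shrinking. Since the two indices of
    a task differ, its two sets can be shrunk independently. *)
Lemma large_free_family (M T I : Type) (tasks : list ((T -> T -> Prop) * I * I))
    (A : I -> T -> Prop) :
  infinite_type M -> (forall i, ~ small M (A i)) ->
  (forall F i j x, In (F, i, j) tasks -> ~ card_le M (sub (F x))) ->
  (forall F i j, In (F, i, j) tasks -> i <> j) ->
  exists A' : I -> T -> Prop,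
    (forall i x, A' i x -> A i x) /\ (forall i, ~ small M (A' i)) /\
    (forall F i j x y, In (F, i, j) tasks -> A' i x -> A' j y -> ~ F x y).
Proof.
  intros iM hA hF hij. induction tasks as [| [[F i] j] tasks IH].
  - exists A. simpl. tauto.
  - destruct IH as (A1 & sA1 & lA1 & fA1).
    { intros G k l x h. apply (hF G k l). right. exact h. }
    { intros G k l h. apply (hij G). right. exact h. }
    destruct (large_free_pair M T F (A1 i) (A1 j)) as (B & C & sB & sC & lB & lC & fBC);
      [exact iM | | apply lA1 | apply lA1 |].
    { intros x _. apply (hF F i j). left. reflexivity. }
    assert (nij : i <> j) by (apply (hij F); left; reflexivity).
    exists (fun k x => A1 k x /\ (k = i -> B x) /\ (k = j -> C x)).
    split; [| split].
    + intros k x [h _]. auto.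
    + intros k h. destruct (classic (k = i)) as [-> | ki].
      * apply lB. revert h. apply small_sub. intros x hx. split; [auto | split; [auto |]].
        intros E. contradiction.
      * destruct (classic (k = j)) as [-> | kj].
        -- apply lC. revert h. apply small_sub. intros x hx.
           split; [auto | split; [| auto]]. intros E. subst. contradiction.
        -- apply (lA1 k). revert h. apply small_sub. intros x hx. tauto.
    + intros G k l x y [E | h] (a1 & b1 & c1) (a2 & b2 & c2).
      * injection E as <- <- <-. apply fBC; auto.
      * apply (fA1 G k l); assumption.
Qed.

(** * Recursion and closure *)

(** Dependent choice with full memory: each choice sees the list of all earlier ones, and [good] is
    the invariant that keeps the recursion going. *)
Lemma strong_choice {S : Type} (s0 : S) (good : S -> Prop) (R : nat -> list S -> S -> Prop) :
  (forall n l, Forall good l -> exists s, good s /\ R n l s) ->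
  exists u : nat -> S, forall n, good (u n) /\ R n (map u (seq 0 n)) (u n).
Proof.
  intros H.
  destruct (choice_on_pred s0 (fun a : nat * list S => Forall good (snd a))
    (fun a s => good s /\ R (fst a) (snd a) s)) as [g hg].
  { intros [n l] h. exact (H n l h). }
  set (hist := fix hist n := match n with
    | 0 => nil
    | Datatypes.S n => hist n ++ [g (n, hist n)] end).
  assert (gh : forall n, Forall good (hist n)).
  { induction n as [| n IH]; simpl; [constructor |].
    apply Forall_app. split; [exact IH |]. constructor; [| constructor].
    exact (proj1 (hg (n, hist n) IH)). }
  exists (fun n => g (n, hist n)). intros n.
  assert (E : map (fun n => g (n, hist n)) (seq 0 n) = hist n).
  { induction n as [| n IH]; [reflexivity |].
    rewrite seq_S, map_app, IH. reflexivity. }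
  rewrite E. exact (hg (n, hist n) (gh n)).
Qed.

(** Iterating [op] omega times suffices, because four arguments occur together at some finite stage;
    each stage adds a union over at most |K| quadruples. *)
Lemma closure_small (K T : Type) (op : T -> T -> T -> T -> T -> Prop) (P : T -> Prop) :
  infinite_type K -> (forall x0 x1 x2 x3, small K (op x0 x1 x2 x3)) -> small K P ->
  exists X : T -> Prop, (forall x, P x -> X x) /\ small K X /\
    forall x0 x1 x2 x3 y, X x0 -> X x1 -> X x2 -> X x3 -> op x0 x1 x2 x3 y -> X y.
Proof.
  intros iK hop hP.
  set (Y := fix Y n := match n with
    | 0 => P
    | S n => fun y => Y n y \/ exists u : (T * T) * (T * T),
        ((Y n (fst (fst u)) /\ Y n (snd (fst u))) /\
         (Y n (fst (snd u)) /\ Y n (snd (snd u)))) /\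
        op (fst (fst u)) (snd (fst u)) (fst (snd u)) (snd (snd u)) y end).
  assert (mono : forall n m x, n <= m -> Y n x -> Y m x).
  { intros n m x h. induction h; [auto |]. intros hx. left. auto. }
  exists (fun x => exists n : nat, True /\ Y n x). split; [| split].
  - intros x px. exists 0. auto.
  - apply small_Union; [exact iK | apply small_full, iK |].
    intros n _. induction n as [| n IH]; [exact hP |].
    apply small_or; [exact iK | exact IH |].
    apply small_Union; [exact iK | |].
    + apply (small_pair K (T * T) (T * T) (fun v => Y n (fst v) /\ Y n (snd v))
        (fun v => Y n (fst v) /\ Y n (snd v))); [exact iK | |];
        apply small_pair; assumption.
    + intros [[x0 x1] [x2 x3]] _. apply hop.
  - intros x0 x1 x2 x3 y [n0 [_ h0]] [n1 [_ h1]] [n2 [_ h2]] [n3 [_ h3]] h.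
    exists (S (n0 + n1 + n2 + n3)). split; [exact I |]. right.
    exists ((x0, x1), (x2, x3)). simpl. split; [| exact h].
    split; split; (eapply mono; [| eassumption]); lia.
Qed.

(** * Well-orders with small initial segments *)

Definition well_order {T : Type} (lt : T -> T -> Prop) : Prop :=
  (forall x, ~ lt x x) /\ (forall x y z, lt x y -> lt y z -> lt x z) /\
  (forall x y, lt x y \/ x = y \/ lt y x) /\ well_founded lt.

Lemma least_element {T : Type} (lt : T -> T -> Prop) (P : T -> Prop) :
  well_founded lt -> (exists x, P x) -> exists x, P x /\ forall y, lt y x -> ~ P y.
Proof.
  intros wf [x hx]. induction x as [x IH] using (well_founded_ind wf).
  destruct (classic (exists y, lt y x /\ P y)) as [[y [yx hy]] | no].
  - exact (IH y yx hy).
  - exists x. split; [exact hx |]. intros y yx hy. eauto.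
Qed.

(** If all segments are small, the set is all of [T]; otherwise it contains the segment below the
    least point whose segment is not small. It serves as a copy of the ordinal |K|^+. *)
Lemma small_below_not_small {T : Type} (lt : T -> T -> Prop) (K : Type) :
  well_order lt -> ~ small K (fun _ : T => True) ->
  ~ small K (fun x => small K (fun y => lt y x)).
Proof.
  intros (_ & _ & _ & wf) hT h.
  destruct (classic (forall x, small K (fun y => lt y x))) as [al | no].
  - apply hT. revert h. apply small_sub. auto.
  - apply not_all_ex_not in no.
    destruct (least_element lt (fun x => ~ small K (fun y => lt y x)) wf no) as [x [hx mx]].
    apply hx. revert h. apply small_sub. intros y yx. apply NNPP. exact (mx y yx).
Qed.

(** A copy of [L] in [W] is cofinal, as a bound would embed [L] into [K]; so [W] is a union of |L|
    many segments of size at most |K|. *)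
Lemma small_of_segments {T : Type} (lt : T -> T -> Prop) (K L : Type) (W : T -> Prop) :
  well_order lt -> infinite_type K -> card_le K L -> ~ card_le L K ->
  (forall w, W w -> small K (fun x => W x /\ lt x w)) -> small L W.
Proof.
  intros (irr & tr & tot & _) iK KL LK hW.
  assert (iL := infinite_le _ _ iK KL).
  destruct (card_le_total L (sub W)) as [[j hj] | h].
  - assert (cof : forall w, W w -> exists d, ~ lt (proj1_sig (j d)) w).
    { intros w ww. apply NNPP. intros no. apply LK.
      destruct (hW w ww) as [g hg]. exists (fun d => g (proj1_sig (j d))).
      assert (inW : forall d, W (proj1_sig (j d)) /\ lt (proj1_sig (j d)) w).
      { intros d. split; [apply proj2_sig |]. apply NNPP. intros n. eauto. }
      intros x y E. apply hj. apply hg in E; auto.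
      destruct (j x), (j y). simpl in E. subst. f_equal. apply proof_irrelevance. }
    apply (small_sub _ _ _ (fun w => exists d : L, True /\
      ((W w /\ lt w (proj1_sig (j d))) \/ w = proj1_sig (j d)))).
    + intros w ww. destruct (cof w ww) as [d hd]. exists d. split; [exact I |].
      destruct (tot w (proj1_sig (j d))) as [h | [h | h]]; tauto.
    + apply small_Union; [exact iL | apply small_full, card_le_refl |].
      intros d _. apply small_or; [exact iL | | apply small_singleton, iL].
      apply (small_le K _ _ _ KL). apply hW. apply proj2_sig.
  - destruct iL as [e _]. apply (card_le_small _ _ _ (e 0) h).
Qed.

(** * Reflection *)

(* [h p] is meant to inject the elements below [p] into the cardinal |K|^+, so
   that a list [s] of ordinals below |K|^+ codes finitely many sets
   {x < p : h p x < nu}; the predicate says that these sets are closed under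
   f(., ., ., a) below p. *)
Definition respects {T : Type} (lt : T -> T -> Prop) (f : T -> T -> T -> T -> T -> Prop)
    (h : T -> T -> T) (p : T) (s : list T) (a : T) : Prop :=
  lt p a /\
  forall nu, In nu s -> forall x0 x1 x2 y,
    lt x0 x1 -> lt x1 x2 -> lt x2 p -> lt y p ->
    lt (h p x0) nu -> lt (h p x1) nu -> lt (h p x2) nu ->
    f x0 x1 x2 a y -> lt (h p y) nu.

(** A stand-in for elementary submodels: only finite codes below |K|^+ are reflected, so that there
    are just |K|^+ many conditions to meet. *)
Definition reflects {T : Type} (lt : T -> T -> Prop) (f : T -> T -> T -> T -> T -> Prop)
    (h : T -> T -> T) (K : Type) (p q : T) : Prop :=
  lt p q /\
  forall s, Forall (fun x => small K (fun y => lt y x)) s -> respects lt f h p s q ->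
    ~ small K (fun a => respects lt f h p s a /\ lt a q).

(* For each code s, the points that violate the conclusion for s form a set all
   of whose initial segments have at most |K| elements, and there are only
   |K|^+ codes. *)
Lemma reflecting_point {T : Type} (lt : T -> T -> Prop) f h (K L : Type) (Q : T -> Prop) (p : T) :
  well_order lt -> infinite_type K -> card_le K L -> ~ card_le L K ->
  small L (fun x => small K (fun y => lt y x)) ->
  ~ small L Q -> small L (fun y => lt y p) ->
  exists q, Q q /\ reflects lt f h K p q.
Proof.
  intros wo iK KL LK hU hQ hp.
  assert (iL := infinite_le _ _ iK KL).
  set (U := fun x => small K (fun y => lt y x)) in *.
  set (G := respects lt f h p).
  set (bad := fun q => ((lt q p) \/ q = p) \/
    exists s, Forall U s /\ (G s q /\ small K (fun a => G s a /\ lt a q))).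
  assert (hbad : small L bad).
  { apply small_or; [exact iL | |].
    - apply small_or; [exact iL | exact hp | apply small_singleton, iL].
    - apply small_Union; [exact iL | |].
      + destruct hU as [g hg]. destruct (card_le_list L iL) as [c hc].
        exists (fun s => c (map g s)). intros s s' hs hs' E. apply hc in E.
        revert s' hs' E. induction hs as [| x s ux us IH]; intros [| x' s'] hs' E;
          try discriminate; [reflexivity |].
        injection E as E1 E2. inversion hs'; subst. f_equal; auto.
      + intros s _. apply (small_of_segments lt K L); auto.
        intros w [gw sw]. revert sw. apply small_sub. intros x [[gx _] xw]. auto. }
  destruct (not_small_inhabited L T _ iL (small_diff _ _ _ _ iL hQ hbad)) as [q [qq nb]].
  exists q. split; [exact qq |]. split.
  - destruct wo as (_ & _ & tot & _). destruct (tot p q) as [h0 | [h0 | h0]]; auto;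
      destruct nb; left; auto.
  - intros s us gs sm. apply nb. right. eauto.
Qed.

(** [nu] is the least strict upper bound of the values [h a] with [a] in [X] below [p]. One exists
    because at most |K| members of [U] are bounded in [U]; by leastness and [down], no point outside
    [X] has a value below [nu]. *)
Lemma segment_code {T : Type} (lt : T -> T -> Prop) (K : Type) (h : T -> T) (p : T)
    (X : T -> Prop) :
  well_order lt -> infinite_type K ->
  ~ small K (fun x => small K (fun y => lt y x)) ->
  (forall a, lt a p -> small K (fun y => lt y (h a))) ->
  small K X ->
  (forall a b, X a -> lt a p -> lt b p -> ~ lt (h a) (h b) -> X b) ->
  exists nu, small K (fun y => lt y nu) /\ forall a, lt a p -> (X a <-> lt (h a) nu).
Proof.
  intros (irr & tr & tot & wf) iK hU hh hX down.
  set (U := fun x => small K (fun y => lt y x)) in *.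
  destruct (least_element lt (fun nu => U nu /\ forall a, X a -> lt a p -> lt (h a) nu) wf)
    as [nu [[unu bnu] mnu]].
  - apply NNPP. intros no. apply hU.
    apply (small_sub _ _ _ (fun x => exists a, (X a /\ lt a p) /\ (lt x (h a) \/ x = h a))).
    + intros x ux. apply NNPP. intros nx. apply no. exists x. split; [exact ux |].
      intros a xa ap. destruct (tot (h a) x) as [c | [c | c]]; [exact c | |];
        destruct nx; exists a; auto.
    + apply small_Union; [exact iK | |].
      * revert hX. apply small_sub. tauto.
      * intros a [_ ap]. apply small_or; [exact iK | exact (hh a ap) |].
        apply small_singleton, iK.
  - exists nu. split; [exact unu |]. intros a ap. split; [auto |]. intros han.
    apply NNPP. intros nxa. apply (mnu (h a) han). split; [exact (hh a ap) |].
    intros b xb bp. apply NNPP. intros nb. apply nxa. exact (down b a xb bp ap nb).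
Qed.

(** * Choice of a transversal *)

(** [Z] holds the points already taken from higher blocks, and the blocks are assumed free for
    triples from [Z]. The induction takes a point [a] of the top block and shrinks the lower blocks
    to be free for triples from [a :: Z]. *)
Lemma select_transversal {M T : Type} (lt : T -> T -> Prop) f :
  infinite_type M -> set_mapping4 T M lt f ->
  forall n (A : nat -> T -> Prop) (Z : list T),
  (forall i, ~ small M (A i)) ->
  (forall i j x y x1 x2 x3, i < n -> j < n -> i <> j ->
     In x1 Z -> In x2 Z -> In x3 Z -> lt x x1 -> lt x1 x2 -> lt x2 x3 ->
     A i x -> A j y -> ~ f x x1 x2 x3 y) ->
  exists H : nat -> T, (forall i, i < n -> A i (H i)) /\
    forall i j x1 x2 x3, i < n -> j < n -> i <> j ->
      (forall z, In z [x1; x2; x3] ->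
         In z Z \/ exists k, i < k /\ j < k /\ k < n /\ z = H k) ->
      lt (H i) x1 -> lt x1 x2 -> lt x2 x3 -> ~ f (H i) x1 x2 x3 (H j).
Proof.
  intros iM sm n. induction n as [| n IH]; intros A Z lA fZ.
  - destruct (not_small_inhabited M T _ iM (lA 0)) as [a _].
    exists (fun _ => a). split; intros; lia.
  - destruct (not_small_inhabited M T _ iM (lA n)) as [a ha].
    (* The order conditions belong to [edge] so that its values have size < |M| for all arguments:
       where they fail, the value is empty. *)
    set (edge := fun x1 x2 x3 x y => lt x x1 /\ lt x1 x2 /\ lt x2 x3 /\ f x x1 x2 x3 y).
    set (tasks := map (fun t : (T * (T * T)) * (nat * nat) =>
        (edge (fst (fst t)) (fst (snd (fst t))) (snd (snd (fst t))), fst (snd t), snd (snd t)))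
      (filter (fun t => negb (Nat.eqb (fst (snd t)) (snd (snd t))))
        (list_prod (list_prod (a :: Z) (list_prod (a :: Z) (a :: Z)))
           (list_prod (seq 0 n) (seq 0 n))))).
    destruct (large_free_family M T nat tasks A) as (A' & sA & lA' & fA'); auto.
    + intros F i j x h. apply in_map_iff in h.
      destruct h as ([[x1 [x2 x3]] [i' j']] & E & _). simpl in E. injection E as <- _ _.
      intros [g hg].
      destruct (classic (lt x x1 /\ lt x1 x2 /\ lt x2 x3)) as [(h1 & h2 & h3) | no].
      * destruct (sm x x1 x2 x3 h1 h2 h3) as [[_ nle] _]. apply nle.
        exists (fun m => exist (f x x1 x2 x3) (proj1_sig (g m))
          (proj2 (proj2 (proj2 (proj2_sig (g m)))))).
        intros m m' E. apply hg. injection E as E. destruct (g m), (g m').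
        simpl in E. subst. f_equal. apply proof_irrelevance.
      * destruct iM as [e _]. destruct (proj2_sig (g (e 0))) as (h1 & h2 & h3 & _). tauto.
    + intros F i j h. apply in_map_iff in h.
      destruct h as ([[x1 [x2 x3]] [i' j']] & E & h). simpl in E. injection E as _ <- <-.
      apply filter_In in h. destruct h as [_ h]. simpl in h.
      destruct (Nat.eqb_spec i' j'); [discriminate | assumption].
    + destruct (IH A' (a :: Z) lA') as (H & hA & hf).
      { intros i j x y x1 x2 x3 hi hj ij z1 z2 z3 l1 l2 l3 ax ay hfy.
        apply (fA' (edge x1 x2 x3) i j x y); auto; [| unfold edge; auto].
        apply in_map_iff. exists ((x1, (x2, x3)), (i, j)). split; [reflexivity |].
        apply filter_In. split.
        - apply in_prod; [apply in_prod; [| apply in_prod]; assumption |].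
          apply in_prod; apply in_seq; lia.
        - simpl. destruct (Nat.eqb_spec i j); [contradiction | reflexivity]. }
      exists (fun i => if Nat.eqb i n then a else H i). split.
      * intros i hi. destruct (Nat.eqb_spec i n) as [-> | ni]; [exact ha |].
        apply sA, hA. lia.
      * intros i j x1 x2 x3 hi hj ij hz l1 l2 l3.
        (* No index lies strictly between [n] and [S n], so above the top block only members of [Z]
           remain. *)
        assert (top : i = n \/ j = n -> In x1 Z /\ In x2 Z /\ In x3 Z).
        { intros c. repeat split;
            match goal with |- In ?z Z =>
              destruct (hz z) as [q | (k & q1 & q2 & q3 & _)]; [simpl; auto | exact q | lia]
            end. }
        destruct (Nat.eqb_spec i n) as [ei | ni], (Nat.eqb_spec j n) as [ej | nj].
        -- lia.
        -- destruct top as (z1 & z2 & z3); [auto |]. subst i.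
           apply (fZ n j a (H j)); auto. apply sA, hA. lia.
        -- destruct top as (z1 & z2 & z3); [auto |]. subst j.
           apply (fZ i n (H i) a); auto. apply sA, hA. lia.
        -- apply hf; auto; try lia. intros z zin.
           destruct (hz z zin) as [q | (k & q1 & q2 & q3 & ->)]; [left; right; exact q |].
           destruct (Nat.eqb_spec k n) as [ek | nk]; [left; left; reflexivity |].
           right. exists k. repeat split; auto. lia.
Qed.

(** * Construction of the blocks *)

Lemma small_In (K T : Type) (l : list T) : infinite_type K -> small K (fun x => In x l).
Proof.
  intros iK. induction l as [| a l IH].
  - destruct iK as [e _]. exists (fun _ => e 0). simpl. tauto.
  - apply (small_sub _ _ _ (fun x => x = a \/ In x l)).
    + intros x [<- | h]; auto.
    + apply small_or; [exact iK | apply small_singleton, iK | exact IH].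
Qed.

(* The second disjunct makes the trace of a closed set below each of its elements
   [x1] an initial segment in the order induced by [h x1]. *)
Definition closing {T : Type} (lt : T -> T -> Prop) (f : T -> T -> T -> T -> T -> Prop)
    (h : T -> T -> T) (Q : T -> Prop) (x0 x1 x2 x3 y : T) : Prop :=
  (lt x0 x1 /\ lt x1 x2 /\ lt x2 x3 /\ f x0 x1 x2 x3 y) \/
  (Q x1 /\ lt x0 x1 /\ lt y x1 /\ ~ lt (h x1 x0) (h x1 y)).

Definition closed_under {T : Type} (op : T -> T -> T -> T -> T -> Prop) (X : T -> Prop) : Prop :=
  forall x0 x1 x2 x3 y, X x0 -> X x1 -> X x2 -> X x3 -> op x0 x1 x2 x3 y -> X y.

(** Besides fewer than |M| values of [f], only points whose [h x1] value is at most [h x1 x0] arise;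
    [h x1] is injective on them and the segment below [h x1 x0] is small. *)
Lemma closing_small {T : Type} (lt : T -> T -> Prop) f h (Q : T -> Prop) (M K : Type) :
  well_order lt -> infinite_type K -> card_le M K -> set_mapping4 T M lt f ->
  (forall p, Q p -> (forall a, lt a p -> small K (fun y => lt y (h p a))) /\
     forall a b, lt a p -> lt b p -> h p a = h p b -> a = b) ->
  forall x0 x1 x2 x3, small K (closing lt f h Q x0 x1 x2 x3).
Proof.
  intros (_ & _ & tot & _) iK MK sm hh x0 x1 x2 x3.
  assert (empty : forall P : T -> Prop, (forall x, ~ P x) -> small K P).
  { intros P no. destruct iK as [e _]. exists (fun _ => e 0). intros x y px.
    destruct (no x px). }
  apply small_or; [exact iK | |].
  - destruct (classic (lt x0 x1 /\ lt x1 x2 /\ lt x2 x3)) as [(h1 & h2 & h3) | no].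
    + destruct (sm x0 x1 x2 x3 h1 h2 h3) as [[le _] _].
      apply (small_sub _ _ _ (f x0 x1 x2 x3)); [tauto |].
      destruct iK as [e _].
      exact (card_le_small _ _ _ (e 0) (card_le_trans _ _ _ le MK)).
    + apply empty. intros y hy. tauto.
  - destruct (classic (Q x1 /\ lt x0 x1)) as [[q l] | no].
    + destruct (hh x1 q) as [seg inj].
      destruct (small_or K T _ (fun x => x = h x1 x0) iK (seg x0 l)
        (small_singleton _ _ _ iK)) as [g hg].
      exists (fun y => g (h x1 y)). intros a b (_ & _ & la & na) (_ & _ & lb & nb) E.
      apply inj; auto. apply hg; [| | exact E].
      * destruct (tot (h x1 a) (h x1 x0)) as [c | [c | c]]; tauto.
      * destruct (tot (h x1 b) (h x1 x0)) as [c | [c | c]]; tauto.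
    + apply empty. intros y hy. tauto.
Qed.

(** Since [q] lies in every member of [l], closure under [f] makes [q] respect the codes of their
    traces below [p]. By reflection so do more than |K| points between [p] and [q]; [A] takes |K| of
    them outside all members of [l], and [X] is a closure. *)
Lemma next_block {T : Type} (lt : T -> T -> Prop) f h (Q : T -> Prop) (M K : Type)
    (P : nat -> T) (p q : T) (l : list (T -> Prop)) :
  well_order lt -> infinite_type K -> card_le M K -> ~ card_le K M ->
  ~ small K (fun x => small K (fun y => lt y x)) ->
  set_mapping4 T M lt f ->
  (forall p, Q p -> (forall a, lt a p -> small K (fun y => lt y (h p a))) /\
     forall a b, lt a p -> lt b p -> h p a = h p b -> a = b) ->
  Q p -> reflects lt f h K p q ->
  (exists n, p = P n) -> (exists n, q = P n) ->
  (forall X, In X l ->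
     small K X /\ (forall n, X (P n)) /\ closed_under (closing lt f h Q) X) ->
  exists A X : T -> Prop,
    (small K X /\ (forall n, X (P n)) /\ closed_under (closing lt f h Q) X) /\
    ~ small M A /\ (forall a, A a -> lt p a /\ lt a q /\ X a) /\
    forall Y, In Y l -> (forall y, Y y -> X y) /\ (forall a, A a -> ~ Y a) /\
      forall a, A a -> forall x0 x1 x2 y, Y x0 -> Y x1 -> Y x2 ->
        lt x0 x1 -> lt x1 x2 -> lt x2 p -> lt y p -> f x0 x1 x2 a y -> Y y.
Proof.
  intros wo iK MK KM hU sm hh Qp [pq refl] [np ep] [nq eq] hl.
  destruct (choice_on_pred p (fun X => In X l) (fun X nu => small K (fun y => lt y nu) /\
    forall a, lt a p -> (X a <-> lt (h p a) nu))) as [c hc].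
  { intros X hX. destruct (hl X hX) as (sX & PX & cX).
    apply (segment_code lt K (h p) p X wo iK hU (proj1 (hh p Qp)) sX).
    intros a b Xa ap bp nab. assert (Xp : X p) by (rewrite ep; apply PX).
    (* The second clause of [closing] is used, with [p] as its [x1]; the third and fourth arguments
       are fillers. *)
    apply (cX a p a a b); auto. right. auto. }
  assert (tr : forall x y z, lt x y -> lt y z -> lt x z) by apply wo.
  assert (qG : respects lt f h p (map c l) q).
  { split; [exact pq |]. intros nu hnu x0 x1 x2 y l01 l12 l2p yp b0 b1 b2 fy.
    apply in_map_iff in hnu. destruct hnu as (X & <- & hX).
    destruct (hc X hX) as [_ cX]. destruct (hl X hX) as (_ & PX & clX).
    apply cX; [exact yp |].
    assert (l1p : lt x1 p) by eauto. assert (l0p : lt x0 p) by eauto.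
    apply (clX x0 x1 x2 q); try (apply cX; assumption).
    - rewrite eq. apply PX.
    - left. repeat split; eauto. }
  apply refl in qG.
  2:{ apply Forall_forall. intros nu hnu. apply in_map_iff in hnu.
      destruct hnu as (X & <- & hX). apply (hc X hX). }
  assert (sl : small K (fun x => exists X, In X l /\ X x)).
  { apply small_Union; [exact iK | apply small_In, iK |]. intros X hX. apply (hl X hX). }
  destruct (not_small_subset M K T _ iK KM (small_diff _ _ _ _ iK qG sl))
    as (A & AG & sA & lA).
  destruct (closure_small K T (closing lt f h Q)
    (fun x => A x \/ ((exists X, In X l /\ X x) \/ exists n, True /\ x = P n)) iK)
    as (X & PX & sX & cX).
  { apply (closing_small lt f h Q M K); assumption. }
  { apply small_or; [exact iK | exact sA |]. apply small_or; [exact iK | exact sl |].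
    apply small_image; [exact iK | apply small_full, iK]. }
  exists A, X. split; [| split; [exact lA | split]].
  - split; [exact sX | split; [| exact cX]]. intros n. apply PX. eauto.
  - intros a ha. destruct (AG a ha) as [[[pa _] aq] _]. auto.
  - intros Y hY. split; [| split].
    + intros y hy. apply PX. eauto.
    + intros a ha Ya. destruct (AG a ha) as [_ no]. eauto.
    + intros a ha x0 x1 x2 y h0 h1 h2 l01 l12 l2p yp fy.
      destruct (AG a ha) as [[[_ ra] _] _]. destruct (hc Y hY) as [_ cY].
      apply cY; [exact yp |].
      apply (ra (c Y) (in_map c l Y hY) x0 x1 x2 y); eauto; apply cY; eauto.
Qed.

(** With [K] the first of the three cardinals, [U] and [Q] play the roles of |K|^+ and |K|^{++}; the
    other two cardinals show that [T] is long enough for both. *)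
Lemma block_sequence {T : Type} (lt : T -> T -> Prop) f (M : Type) :
  infinite_type M -> well_order lt -> card_ge_succ3 M T -> set_mapping4 T M lt f ->
  exists (P : nat -> T) (A X : nat -> T -> Prop),
    (forall n, lt (P n) (P (S n))) /\
    (forall n, ~ small M (A n)) /\
    (forall n a, A n a -> lt (P n) a /\ lt a (P (S n)) /\ X n a) /\
    (forall n x0 x1 x2 x3 y, lt x0 x1 -> lt x1 x2 -> lt x2 x3 ->
       X n x0 -> X n x1 -> X n x2 -> X n x3 -> f x0 x1 x2 x3 y -> X n y) /\
    forall i n, i < n ->
      (forall y, X i y -> X n y) /\ (forall a, A n a -> ~ X i a) /\
      forall a, A n a -> forall x0 x1 x2 y, X i x0 -> X i x1 -> X i x2 ->
        lt x0 x1 -> lt x1 x2 -> lt x2 (P n) -> lt y (P n) -> f x0 x1 x2 a y -> X i y.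
Proof.
  intros iM wo (A1 & A2 & A3 & [MK KM] & [K2 n2] & [le3 n3]) sm.
  set (K := sub A1) in *. assert (iK := infinite_le _ _ iM MK).
  set (U := fun x : T => small K (fun y => lt y x)).
  assert (hU : ~ small K U).
  { apply small_below_not_small; [exact wo |]. intros [g hg]. apply n2.
    apply small_card_le. exists g. auto. }
  set (L := sub U).
  assert (KL : card_le K L) by exact (not_small_infinite _ _ _ iK hU).
  assert (iL := infinite_le _ _ iK KL).
  assert (LK : ~ card_le L K).
  { intros le. apply hU. destruct iK as [e _]. exact (card_le_small _ _ _ (e 0) le). }
  assert (sU : small L U).
  { destruct iL as [e _]. exact (card_le_small _ _ _ (e 0) (card_le_refl _)). }
  assert (L2 : card_le L (sub A2)).
  { apply small_card_le. apply (small_of_segments lt K); auto.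
    intros w hw. revert hw. apply small_sub. tauto. }
  set (Q := fun x : T => small L (fun y => lt y x)).
  assert (hQ : ~ small L Q).
  { apply small_below_not_small; [exact wo |]. intros [g hg]. apply n3.
    apply (card_le_trans _ L); [| exact L2]. apply small_card_le. exists g. auto. }
  destruct (not_small_inhabited L T Q iL hQ) as [p0 Qp0].
  (* As [L] is the type of members of [U], a witness of [Q p] already injects the points below [p]
     into [U]. *)
  destruct (choice_on_pred (fun x : T => x) Q (fun p g =>
     (forall a, lt a p -> small K (fun y => lt y (g a))) /\
     forall a b, lt a p -> lt b p -> g a = g b -> a = b)) as [h hh].
  { intros p [g hg]. exists (fun a => proj1_sig (g a)). split.
    - intros a _. apply (proj2_sig (g a)).
    - intros a b la lb E. apply hg; auto. destruct (g a), (g b). simpl in E. subst.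
      f_equal. apply proof_irrelevance. }
  destruct (choice_on_pred p0 Q (fun p q => Q q /\ reflects lt f h K p q)) as [nx hnx].
  { intros p Qp. apply (reflecting_point lt f h K L); auto. }
  (* All these points are fixed before any closed set is chosen, since each closed set has to
     contain all of them. *)
  set (P := fun n => Nat.iter n nx p0).
  assert (QP : forall n, Q (P n)).
  { induction n as [| n IH]; [exact Qp0 | exact (proj1 (hnx _ IH))]. }
  assert (PP : forall n, reflects lt f h K (P n) (P (S n))).
  { intros n. apply (hnx (P n)). apply QP. }
  set (good := fun X : T -> Prop =>
    small K X /\ (forall n, X (P n)) /\ closed_under (closing lt f h Q) X).
  destruct (strong_choice (fun _ : T => True, fun _ : T => True) (fun s => good (snd s))
    (fun n l s => ~ small M (fst s) /\
       (forall a, fst s a -> lt (P n) a /\ lt a (P (S n)) /\ snd s a) /\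
       forall Y, In Y (map snd l) -> (forall y, Y y -> snd s y) /\
         (forall a, fst s a -> ~ Y a) /\
         forall a, fst s a -> forall x0 x1 x2 y, Y x0 -> Y x1 -> Y x2 ->
           lt x0 x1 -> lt x1 x2 -> lt x2 (P n) -> lt y (P n) -> f x0 x1 x2 a y -> Y y))
    as [u hu].
  { intros n l gl.
    destruct (next_block lt f h Q M K P (P n) (P (S n)) (map snd l)) as (A & X & gX & rest);
      eauto.
    - intros X hX. apply in_map_iff in hX. destruct hX as (s & <- & hs).
      rewrite Forall_forall in gl. exact (gl s hs).
    - exists (A, X). split; [exact gX | exact rest]. }
  exists P, (fun n => fst (u n)), (fun n => snd (u n)).
  split; [| split; [| split; [| split]]].
  - intros n. apply PP.
  - intros n. apply hu.
  - intros n a. apply (hu n).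
  - intros n x0 x1 x2 x3 y l01 l12 l23 h0 h1 h2 h3 fy.
    destruct (hu n) as [(_ & _ & cl) _]. apply (cl x0 x1 x2 x3); auto. left. auto.
  - intros i n hin. apply (hu n). apply in_map_iff. exists (u i). split; [reflexivity |].
    apply in_map, in_seq. lia.
Qed.

(** * Freeness of the transversal *)

Theorem theorem4p1 (M T : Type) (lt : T -> T -> Prop)
  (f : T -> T -> T -> T -> T -> Prop) :
  infinite_type M ->
  is_initial_ordinal T lt ->
  card_ge_succ3 M T ->
  set_mapping4 T M lt f ->
  (forall x0 x1 x2 x3, lt x0 x1 -> lt x1 x2 -> lt x2 x3 ->
     forall y, lt x1 y -> lt y x2 -> ~ f x0 x1 x2 x3 y) ->
  forall m : nat, exists H : list T,
    NoDup H /\ length H = m /\ free_set lt f H.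
Proof.
  intros iM (irr & tr & tot & wf & _) big sm mid m.
  assert (wo : well_order lt) by exact (conj irr (conj tr (conj tot wf))).
  destruct (block_sequence lt f M iM wo big sm) as (P & A & X & Pinc & lA & AP & clX & step).
  destruct (select_transversal lt f iM sm m A nil lA) as (H & HA & Hfree).
  { simpl. tauto. }
  assert (Ple : forall i j, i <= j -> P i = P j \/ lt (P i) (P j)).
  { intros i j h. induction h as [| j h [-> | IH]]; eauto. }
  assert (HP : forall i j, i < j -> i < m -> lt (H i) (P j)).
  { intros i j ij im. destruct (AP i (H i) (HA i im)) as (_ & h & _).
    destruct (Ple (S i) j ij) as [<- | h']; eauto. }
  assert (Hinc : forall i j, i < j -> j < m -> lt (H i) (H j)).
  { intros i j ij jm. destruct (AP j (H j) (HA j jm)) as (h & _).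
    apply (tr _ (P j)); [apply HP; lia | exact h]. }
  assert (Hlt : forall i j, i < m -> j < m -> lt (H i) (H j) -> i < j).
  { intros i j im jm h. destruct (Nat.lt_trichotomy i j) as [c | [c | c]]; [exact c | |].
    - subst j. destruct (irr _ h).
    - destruct (irr (H i)). apply (tr _ _ _ h). auto. }
  assert (HX : forall i n, i <= n -> i < m -> X n (H i)).
  { intros i n hin im. destruct (AP i (H i) (HA i im)) as (_ & _ & h).
    destruct (Nat.eq_dec i n) as [<- | ne]; [exact h |].
    apply (step i n); [lia | exact h]. }
  exists (map H (seq 0 m)). split; [| split].
  - apply NoDup_map_NoDup_ForallPairs; [| apply seq_NoDup].
    intros i j hi hj E. apply in_seq in hi, hj.
    destruct (Nat.lt_trichotomy i j) as [c | [c | c]]; [| exact c |]; exfalso.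
    + apply (irr (H i)). rewrite E at 2. apply Hinc; lia.
    + apply (irr (H i)). rewrite E at 1. apply Hinc; lia.
  - rewrite length_map, length_seq. reflexivity.
  - intros x0 x1 x2 x3 h0 h1 h2 h3 l01 l12 l23 y hy fy.
    apply in_map_iff in h0, h1, h2, h3, hy.
    destruct h0 as (k0 & <- & h0), h1 as (k1 & <- & h1), h2 as (k2 & <- & h2),
      h3 as (k3 & <- & h3), hy as (j & <- & hy).
    apply in_seq in h0, h1, h2, h3, hy.
    assert (k01 := Hlt k0 k1 ltac:(lia) ltac:(lia) l01).
    assert (k12 := Hlt k1 k2 ltac:(lia) ltac:(lia) l12).
    assert (k23 := Hlt k2 k3 ltac:(lia) ltac:(lia) l23).
    destruct (sm _ _ _ _ l01 l12 l23) as (_ & n0 & n1 & n2 & n3).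
    destruct (Nat.eq_dec j k0) as [-> | j0]; [auto |].
    destruct (Nat.eq_dec j k1) as [-> | j1]; [auto |].
    destruct (Nat.eq_dec j k2) as [-> | j2]; [auto |].
    destruct (Nat.eq_dec j k3) as [-> | j3]; [auto |].
    (* If y is below x1, on either side of x0, the transversal was chosen to avoid it: [k1], [k2],
       [k3] exceed both [k0] and [j]. *)
    destruct (Nat.lt_ge_cases j k1) as [c1 | c1].
    + apply (Hfree k0 j (H k1) (H k2) (H k3)); auto; try lia.
      intros z [<- | [<- | [<- | []]]]; right; [exists k1 | exists k2 | exists k3];
        repeat split; lia.
    + destruct (Nat.lt_ge_cases j k2) as [c2 | c2].
      * apply (mid _ _ _ _ l01 l12 l23 (H j)); auto; apply Hinc; lia.
      (* Now y is above x2. It lies in block [S i], which misses [X i], while x0, x1, x2 lie in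
         [X i]; so it suffices to put y into [X i]. *)
      * destruct j as [| i]; [lia |].
        destruct (step i (S i)) as (_ & nX & _); [lia |].
        apply (nX (H (S i))); [apply HA; lia |].
        destruct (Nat.lt_ge_cases (S i) k3) as [c3 | c3].
        (* For y between x2 and x3, reflection at x3 keeps the values below [P k3] inside [X i]. *)
        -- destruct (step i k3) as (_ & _ & refl); [lia |].
           apply (refl (H k3) ltac:(apply HA; lia) (H k0) (H k1) (H k2) (H (S i)));
             auto; try (apply HX; lia); apply HP; lia.
        (* For y above x3, all four arguments lie in [X i], which is closed under [f]. *)
        -- apply (clX i (H k0) (H k1) (H k2) (H k3)); auto; apply HX; lia.
Qed.
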